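(* Let $\mathcal{Z}$ be a reflexive Banach space, $\mathcal{D}$ a Hilbert space, $N\ge 0$ an integer, $\mathbf{z}_0^b\in\mathcal{Z}$, and $\mathbf{y}_0,\dots,\mathbf{y}_N\in\mathcal{D}$. Let $\mathbf{B}$, $\mathbf{R}_k$, $\mathbf{L}_k$ ($0\le k\le N$) be symmetric positive-definite covariance operators as described in the context, satisfying the predictability assumption that $\mathbf{R}_k^{-1}-\mathbf{L}_k^{-1}$ is positive definite for every $k$. Let $Q_k:\mathcal{Z}\to\mathcal{D}$ ($0\le k\le N$) be maps such that: (i) each $Q_k$ is weak-to-strong continuous: whenever $\mathbf{z}_n\rightharpoonup\mathbf{z}$ weakly in $\mathcal{Z}$, $Q_k(\mathbf{z}_n)\to Q_k(\mathbf{z})$ strongly in $\mathcal{D}$; (ii) each $Q_k$ satisfies a linear growth condition: there exists $C_k>0$ with $\|Q_k(\mathbf{z}_0)\|_{\mathcal{D}}\le C_k(1+\|\mathbf{z}_0\|_{\mathcal{Z}})$ for all $\mathbf{z}_0\in\mathcal{Z}$. Define $\mathcal{J}_{\mathrm{DC}}:\mathcal{Z}\to\mathbb{R}$ by $$\mathcal{J}_{\mathrm{DC}}(\mathbf{z}_0)=\tfrac12\|\mathbf{z}_0-\mathbf{z}_0^b\|_{\mathbf{B}^{-1}}^2+\tfrac12\sum_{k=0}^N\|\mathbf{y}_k-Q_k(\mathbf{z}_0)\|_{\mathbf{R}_k^{-1}}^2-\tfrac12\sum_{k=0}^N\|Q_k(\mathbf{z}_0)-Q_k(\mathbf{z}_0^b)\|_{\mathbf{L}_k^{-1}}^2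 .$$ Then $\mathcal{J}_{\mathrm{DC}}$ is (sequentially) weakly lower semicontinuous and coercive on $\mathcal{Z}$ (that is, $\mathcal{J}_{\mathrm{DC}}(\mathbf{z}_0)\to\infty$ as $\|\mathbf{z}_0\|_{\mathcal{Z}}\to\infty$), and it admits a minimizer: there exists $\mathbf{z}^*\in\mathcal{Z}$ with $\mathcal{J}_{\mathrm{DC}}(\mathbf{z}^* )=\inf_{\mathbf{z}_0\in\mathcal{Z}}\mathcal{J}_{\mathrm{DC}}(\mathbf{z}_0)$.
   Context: All spaces are real. The precision operator $\mathbf{B}^{-1}:\mathcal{Z}\to\mathcal{Z}^*$ is bounded, symmetric and positive definite in the sense that there is a constant $\lambda_{\min}(\mathbf{B}^{-1})>0$ with $\langle\mathbf{B}^{-1}\mathbf{v},\mathbf{v}\rangle\ge\lambda_{\min}(\mathbf{B}^{-1})\|\mathbf{v}\|_{\mathcal{Z}}^2$ for all $\mathbf{v}\in\mathcal{Z}$; $\|\mathbf{v}\|_{\mathbf{B}^{-1}}^2:=\langle\mathbf{B}^{-1}\mathbf{v},\mathbf{v}\rangle$. For each $k$, $\mathbf{R}_k$ and $\mathbf{L}_k$ are bounded, symmetric (self-adjoint) positive-definite operators on $\mathcal{D}$ with bounded inverses; $\|\mathbf{d}\|_{\mathbf{R}_k^{-1}}^2:=\langle\mathbf{R}_k^{-1}\mathbf{d},\mathbf{d}\rangle$ and $\|\mathbf{d}\|_{\mathbf{L}_k^{-1}}^2:=\langle\mathbf{L}_k^{-1}\mathbf{d},\mathbf{d}\rangle$ for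 $\mathbf{d}\in\mathcal{D}$. The predictability assumption: the operator $\mathbf{W}_k^{-1}:=\mathbf{R}_k^{-1}-\mathbf{L}_k^{-1}$ satisfies $\langle\mathbf{W}_k^{-1}\mathbf{d},\mathbf{d}\rangle>0$ for all $\mathbf{d}\in\mathcal{D}\setminus\{0\}$ and all $k$. *)

(* Defs.v *)
From HB Require Import structures.
From mathcomp Require Import all_boot all_order all_algebra.
From mathcomp Require Import all_classical all_reals all_analysis.

Set Implicit Arguments.
Unset Strict Implicit.
Unset Printing Implicit Defensive.

Import Order.TTheory GRing.Theory Num.Theory.
Import numFieldNormedType.Exports.

Local Open Scope classical_set_scope.
Local Open Scope ring_scope.

Section dual_space.
Context {R : realType} {Z : normedModType R}.

Definition is_dual_fun : {pred Z -> R^o} :=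
  mem [set f : Z -> R^o | linear f /\ continuous f].

Lemma is_dual_funP (f : Z -> R^o) :
  reflect (linear f /\ continuous f) (f \in is_dual_fun).
Proof. by apply: (iffP idP); rewrite in_setE. Qed.

Lemma is_dual_fun_submod_closed : submod_closed is_dual_fun.
Proof.
split; first by apply/is_dual_funP; split=> [a x y|x];
  [rewrite /= scaler0 addr0 | exact: cvg_cst].
move=> a f g /is_dual_funP[lf cf] /is_dual_funP[lg cg].
apply/is_dual_funP; split=> [b x y|x].
  rewrite !fctE lf lg !scalerDr !scalerA [a * b]mulrC -!addrA.
  by congr (_ + _); rewrite addrCA.
apply: (@cvgD R R^o _ _ _ (a \*: f) g); last exact: cg.
by apply: cvgZl_tmp; exact: cf.
Qed.

HB.instance Definition _ :=
  GRing.isSubmodClosed.Build R (Z -> R^o) is_dual_fun is_dual_fun_submod_closed.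

End dual_space.

Record dual (R : realType) (Z : normedModType R) := Dual {
  dual_fun :> Z -> R^o ;
  dual_funP : dual_fun \in is_dual_fun }.

Section dual_space_structure.
Context {R : realType} {Z : normedModType R}.

HB.instance Definition _ := [isSub for @dual_fun R Z].
HB.instance Definition _ := [Choice of dual Z by <:].
HB.instance Definition _ := [SubChoice_isSubLmodule of dual Z by <:].

Lemma dual_linear (f : dual Z) : linear f.
Proof. by have /is_dual_funP[] := dual_funP f. Qed.

HB.instance Definition _ (f : dual Z) :=
  GRing.isLinear.Build R Z R^o _ (dual_fun f) (dual_linear f).

Lemma dual_continuous (f : dual Z) : continuous f.
Proof. by have /is_dual_funP[] := dual_funP f. Qed.

Lemma dual_addE (f g : dual Z) x : (f + g) x = f x + g x. Proof. by []. Qed.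

Lemma dual_scaleE (a : R) (f : dual Z) x : (a *: f) x = a * f x.
Proof. by []. Qed.

Lemma dual_ext (f g : dual Z) : (forall x, f x = g x) -> f = g.
Proof. by move=> fg; apply/val_inj/funext. Qed.

Definition dual_norm (f : dual Z) : R := sup [set `|f x| | x in [set x : Z | `|x| <= 1]].

Lemma has_sup_dual_norm (f : dual Z) :
  has_sup [set `|f x| | x in [set x : Z | `|x| <= 1]].
Proof.
split; first by exists `|f 0|, 0 => //=; rewrite normr0.
have /linear_bounded_continuous/bounded_funP/(_ 1)[M fM] := @dual_continuous f.
by exists M => _ [x /= x1 <-]; exact: fM.
Qed.

Lemma dual_norm_ub (f : dual Z) x : `|x| <= 1 -> `|f x| <= dual_norm f.
Proof.
move=> x1; apply: sup_upper_bound; first exact: has_sup_dual_norm.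
by exists x.
Qed.

Lemma dual_norm_le (f : dual Z) (M : R) :
  (forall x, `|x| <= 1 -> `|f x| <= M) -> dual_norm f <= M.
Proof.
move=> fM; apply: ge_sup; first by have [] := has_sup_dual_norm f.
by move=> _ [x /= x1 <-]; exact: fM.
Qed.

Lemma dual_norm_ge0 (f : dual Z) : 0 <= dual_norm f.
Proof. by apply: le_trans (@dual_norm_ub f 0 _) => //; rewrite normr0. Qed.

Lemma dual_normP (f : dual Z) x : `|f x| <= dual_norm f * `|x|.
Proof.
have [->|x0] := eqVneq x 0; first by rewrite linear0 !normr0 mulr0.
have nx : 0 < `|x| by rewrite normr_gt0.
have /(dual_norm_ub f) : `| `|x|^-1 *: x | <= 1.
  by rewrite normrZ normfV normr_id mulVf// gt_eqF.
by rewrite linearZ/= normrZ normfV normr_id mulrC ler_pdivrMr.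
Qed.

Lemma dual_normD (f g : dual Z) : dual_norm (f + g) <= dual_norm f + dual_norm g.
Proof.
apply: dual_norm_le => x x1; rewrite dual_addE (le_trans (ler_normD _ _))//.
by rewrite lerD// dual_norm_ub.
Qed.

Lemma dual_normZ (a : R) (f : dual Z) : dual_norm (a *: f) = `|a| * dual_norm f.
Proof.
have leZ (b : R) (g : dual Z) : dual_norm (b *: g) <= `|b| * dual_norm g.
  apply: dual_norm_le => x x1.
  by rewrite dual_scaleE normrM ler_wpM2l// dual_norm_ub.
apply/eqP; rewrite eq_le leZ/=.
have [->|a0] := eqVneq a 0; first by rewrite normr0 mul0r dual_norm_ge0.
rewrite -ler_pdivlMl ?normr_gt0// -normfV.
by rewrite -[X in dual_norm X <= _](scalerK a0) leZ.
Qed.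

Lemma dual_norm0_eq0 (f : dual Z) : dual_norm f = 0 -> f = 0.
Proof.
move=> f0; apply: dual_ext => x; apply/eqP; rewrite -normr_le0.
by rewrite (le_trans (dual_normP f x))// f0 mul0r.
Qed.

HB.instance Definition _ :=
  Lmodule_isNormed.Build R (dual Z) dual_normD dual_normZ dual_norm0_eq0.

End dual_space_structure.

(* The canonical embedding of Z into Z^** is onto. *)
Definition reflexive_space (R : realType) (Z : normedModType R) :=
  forall phi : dual (dual Z), exists z : Z, forall f : dual Z, phi f = f z.

Definition weak_cvg (R : realType) (Z : normedModType R) (u : nat -> Z) (z : Z) :=
  forall f : dual Z, f (u n) @[n --> \oo] --> f z.

Definition weak_to_strong_continuous (R : realType) (Z D : normedModType R)
    (Q : Z -> D) :=
  forall (u : nat -> Z) (z : Z), weak_cvg u z -> Q (u n) @[n --> \oo] --> Q z.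

Definition linear_growth (R : realType) (Z D : normedModType R) (Q : Z -> D) :=
  exists2 C : R, 0 < C & forall z : Z, `|Q z| <= C * (1 + `|z|).

Definition seq_weakly_lsc (R : realType) (Z : normedModType R) (J : Z -> R) :=
  forall (u : nat -> Z) (z : Z), weak_cvg u z ->
    ((J z)%:E <= limn_einf (fun n => (J (u n))%:E))%E.

Definition coercive (R : realType) (Z : normedModType R) (J : Z -> R) :=
  forall M : R, exists r : R, forall z : Z, r <= `|z| -> M <= J z.

(* [B] is a covariance operator Z^* -> Z and [Binv] the precision operator
   B^-1 : Z -> Z^*; the duality pairing <B^-1 u, v> is [Binv u v].
   Linearity and boundedness of [B] follow from those of [Binv]. *)
Definition covariance_with_precision (R : realType) (Z : normedModType R)
    (B : dual Z -> Z) (Binv : {linear Z -> dual Z}) :=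
  [/\ cancel B Binv, cancel Binv B, continuous Binv,
      forall u v : Z, Binv u v = Binv v u &
      exists2 lmin : R, 0 < lmin & forall v : Z, lmin * `|v| ^+ 2 <= Binv v v].

(* A normed space with an inner product [ip] inducing its norm; on a
   [completeNormedModType] this is a Hilbert space. *)
Definition hilbert_norm (R : realType) (D : normedModType R)
    (ip : {dot D for idfun}) :=
  forall d : D, `|d| ^+ 2 = ip d d.

Definition positive_definite (R : realType) (D : normedModType R)
    (ip : {dot D for idfun}) (A : D -> D) :=
  forall d : D, d != 0 -> 0 < ip (A d) d.

Definition covariance_operator (R : realType) (D : normedModType R)
    (ip : {dot D for idfun}) (A Ainv : {linear D -> D}) :=
  [/\ continuous A, forall d e : D, ip (A d) e = ip d (A e),
      positive_definite ip A &
      [/\ continuous Ainv, cancel A Ainv & cancel Ainv A]].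

Definition J_DC (R : realType) (Z D : normedModType R) (ip : {dot D for idfun})
    (N : nat) (Binv : {linear Z -> dual Z}) (Rinv Linv : 'I_N.+1 -> {linear D -> D})
    (Q : 'I_N.+1 -> Z -> D) (zb : Z) (y : 'I_N.+1 -> D) (z : Z) : R :=
  let sqnorm_Binv (v : Z) := Binv v v in
  let sqnorm (A : {linear D -> D}) (d : D) := ip (A d) d in
  2^-1 * sqnorm_Binv (z - zb)
  + 2^-1 * \sum_(k < N.+1) sqnorm (Rinv k) (y k - Q k z)
  - 2^-1 * \sum_(k < N.+1) sqnorm (Linv k) (Q k z - Q k zb).

(* Main.v *)
Require Import Defs.
From HB Require Import structures.
From mathcomp Require Import all_boot all_order all_algebra.
From mathcomp Require Import all_classical all_reals all_analysis.
From mathcomp Require Import ring lra.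
Import Order.TTheory GRing.Theory Num.Theory.
Import numFieldNormedType.Exports.
Local Open Scope classical_set_scope.
Local Open Scope ring_scope.

(** The background term is convex and continuous, hence weakly lower
semicontinuous through its tangent minorants, and the observation terms are
weakly continuous because the [Q k] are weak-to-strong continuous. Expanding the
observation terms, the quadratic part in [Q k z] is governed by
[Rinv k - Linv k >= 0], so their sum is at least a negative multiple of
[1 + `|z|], which the background term dominates: the cost is coercive. A
minimizing sequence is then bounded. Since [Binv] is an inner product on the
reflexive space [Z], it has a weakly convergent subsequence, whose limit is a
minimizer by lower semicontinuity. *)

(** * Ultrafilters and convergence *)

Lemma ultra_fmap (T X : Type) (U : set_system T) (g : T -> X) :
  UltraFilter U -> UltraFilter (g @ U).
Proof.
move=> UU.
have PU : ProperFilter U by exact: ultra_proper.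
split; first exact: fmap_proper_filter.
move=> G PG subG; apply/seteqP; split=> // A GA.
have [//|UnA] := in_ultra_setVsetC (g @^-1` A) UU.
have /subG GnA : (g @ U) (~` A) by [].
have : G (A `&` ~` A) by exact: filterI.
by rewrite setICr => /filter_not_empty.
Qed.

(** Otherwise the preimage of some neighbourhood of [l] is missing from [F], its complement is
    compatible with [F], and an ultrafilter containing both contradicts the hypothesis. *)
Lemma cvg_ultrafilters (T : Type) (X : topologicalType) (F : set_system T)
    (g : T -> X) (l : X) : Filter F ->
  (forall U : set_system T, UltraFilter U -> F `<=` U -> g @ U --> l) ->
  g @ F --> l.
Proof.
move=> FF ultra_cvg A Al; apply: contrapT => nFA.
have PF : ProperFilter (within (~` (g @^-1` A)) F).
  apply: (Build_ProperFilter_ex _ (within_filter _ FF)) => P FP.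
  apply: contrapT => nP; apply: nFA.
  apply: (@filterS _ F _ _ _ _ FP) => x PxA; apply: contrapT => nAx.
  by apply: nP; exists x; exact: PxA.
have [U [UU subU]] := ultraFilterLemma PF.
have PU : ProperFilter U by exact: ultra_proper.
have UA : U (g @^-1` A).
  by apply: ultra_cvg Al => // P FP; apply: subU; exact: filterS FP.
have UnA : U (~` (g @^-1` A)) by apply: subU; exact: withinT.
have : U ((g @^-1` A) `&` ~` (g @^-1` A)) by exact: filterI.
by rewrite setICr => /filter_not_empty.
Qed.

Lemma ultra_bounded_cvg (R : realType) (T : Type) (U : set_system T)
    (g : T -> R) (M : R) :
  UltraFilter U -> (forall x, `|g x| <= M) -> exists l : R, g @ U --> l.
Proof.
move=> UU gM.
have PU : ProperFilter U by exact: ultra_proper.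
have := @segment_compact R (- M) M; rewrite compact_ultra.
move=> /(_ (g @ U) (ultra_fmap T R U g UU))[|l [_ gl]].
  by apply: (@filterE _ U) => x; rewrite /= in_itv/= -ler_norml.
by exists l.
Qed.

(** * Weak compactness and the direct method *)

Section weak_sequential_compactness.
Context {R : realType} {Z : normedModType R}.

(** The limits of [f (u n)] along [U], which exist for all [f] at once, form a functional on
    [dual Z] of norm at most [M]; reflexivity represents it by a point. *)
Lemma reflexive_ultra_weak_cvg (U : set_system nat) (u : nat -> Z) (M : R) :
  reflexive_space Z -> UltraFilter U -> (forall n, `|u n| <= M) ->
  exists z : Z, forall f : dual Z, f (u n) @[n --> U] --> f z.
Proof.
move=> reflZ UU uM.
have PU : ProperFilter U by exact: ultra_proper.
have M0 : 0 <= M by exact: le_trans (uM 0%N).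
have fuM (f : dual Z) n : `|f (u n)| <= dual_norm f * M.
  by rewrite (le_trans (dual_normP f _))// ler_wpM2l// dual_norm_ge0.
have /choice[phi phiE] : forall f : dual Z, exists l : R, f (u n) @[n --> U] --> l.
  by move=> f; exact: ultra_bounded_cvg UU (fuM f).
have phi_unique (f : dual Z) (l : R) : f (u n) @[n --> U] --> l -> phi f = l.
  by move=> fl; apply: (@cvg_unique R^o _ _ _ _ _ (phiE f) fl); exact: Rhausdorff.
have phi_linear : linear (phi : dual Z -> R^o).
  move=> a f g; apply: phi_unique.
  by apply: cvgD; [apply: cvgMl_tmp; exact: phiE|exact: phiE].
have phi_le f : `|phi f| <= dual_norm f * M.
  apply: (cvgr_to_le (cvg_norm (phiE f))).
  by apply: nearW => n; exact: fuM.
pose philin : {linear dual Z -> R^o} :=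
  HB.pack (phi : dual Z -> R^o) (GRing.isLinear.Build R (dual Z) R^o _ _ phi_linear).
have phi_cont : continuous (phi : dual Z -> R^o).
  apply/(@linear_bounded_continuous _ _ _ philin)/bounded_funP => r.
  exists (r * M) => f fr; rewrite (le_trans (phi_le f))// ler_wpM2r//.
have phi_dual : (phi : dual Z -> R^o) \in is_dual_fun by apply/is_dual_funP.
have [z zE] := reflZ (Dual phi_dual).
by exists z => f; rewrite -zE; exact: phiE.
Qed.

(* The weak limit [z] is fixed along an ultrafilter before the subsequence is
   extracted, which replaces the diagonal argument. Any weak limit [z'] of the
   subsequence along a finer ultrafilter has the same pairings with all [u m],
   and [z - z'] is orthogonal to the [u m], hence to [z] and [z'] themselves. *)
Lemma symmetric_form_weak_compact (A : {linear Z -> dual Z}) (u : nat -> Z) (M : R) :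
  reflexive_space Z -> (forall v w, A v w = A w v) ->
  (forall v, v != 0 -> 0 < A v v) -> (forall n, `|u n| <= M) ->
  exists (z : Z) (s : nat -> nat),
    (forall n, (n <= s n)%N) /\ weak_cvg (u \o s) z.
Proof.
move=> reflZ Asym Apos uM.
have [U [UU subU]] := ultraFilterLemma (eventually_filter).
have PU : ProperFilter U by exact: ultra_proper.
have [z uz] := reflexive_ultra_weak_cvg U u M reflZ UU uM.
(* A tail and finitely many closeness conditions all belong to [U], so some index satisfies them
   together. *)
have /choice[s sP] : forall j, exists n, (j <= n)%N /\
    forall m : 'I_j.+1, `|A (u m) z - A (u m) (u n)| < j.+1%:R^-1.
  move=> j; apply: (@filter_ex _ U); apply: filterI.
    by apply: subU; exact: nbhs_infty_ge.
  apply: filter_forall => m; have /cvgrPdist_lt/(_ j.+1%:R^-1) := uz (A (u m)).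
  by apply; rewrite invr_gt0.
exists z, s; split; first by move=> n; have [] := sP n.
have usz m : A (u m) (u (s j)) @[j --> \oo] --> A (u m) z.
  apply/cvgrPdist_lt => e e0; near=> j.
  have mj : (m < j.+1)%N by rewrite ltnS; near: j; exact: nbhs_infty_ge.
  have [_ /(_ (Ordinal mj))/= /lt_trans] := sP j; apply.
  by near: j; exact: (near_infty_natSinv_lt (PosNum e0)).
move=> f; apply: cvg_ultrafilters => V UV subV.
have PV : ProperFilter V by exact: ultra_proper.
have [z' wz'] := reflexive_ultra_weak_cvg V (u \o s) M reflZ UV (fun n => uM _).
suff -> : z = z' by exact: wz'.
have lim_eq (W : set_system nat) (g : nat -> R^o) (l l' : R^o) : ProperFilter W ->
    g @ W --> l -> g @ W --> l' -> l = l'.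
  by move=> PW; exact: (@cvg_unique R^o (@Rhausdorff R)).
have Az m : A (u m) z = A (u m) z'.
  have usz' : A (u m) (u (s j)) @[j --> V] --> A (u m) z.
    by move=> P /usz; exact: subV.
  exact: lim_eq PV usz' (wz' (A (u m))).
have zz'_u m : A (z - z') (u m) = 0 by rewrite Asym linearB/= Az subrr.
(* The functional [A (z - z')] vanishes on every [u m]; its limits along [U] and [V] are its values
   at [z] and [z']. *)
have zz'_z : A (z - z') z = 0.
  have /lim_eq := uz (A (z - z')); apply.
  by under eq_fun do rewrite zz'_u; exact: cvg_cst.
have zz'_z' : A (z - z') z' = 0.
  have /lim_eq := wz' (A (z - z')); apply.
  by under eq_fun do rewrite /= zz'_u; exact: cvg_cst.
apply/eqP; rewrite -subr_eq0; apply/negPn/negP => /Apos.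
by rewrite linearB/= zz'_z zz'_z' subrr ltxx.
Unshelve. all: by end_near. Qed.

(** The direct method. The infimum is taken in the extended reals, as [J] is not known beforehand to
    be bounded below; being attained makes it finite. *)
Lemma lsc_coercive_minimizer (J : Z -> R) :
  (forall (u : nat -> Z) (M : R), (forall n, `|u n| <= M) ->
    exists (z : Z) (s : nat -> nat),
      (forall n, (n <= s n)%N) /\ weak_cvg (u \o s) z) ->
  seq_weakly_lsc J -> coercive J ->
  exists z : Z, (J z)%:E = ereal_inf [set (J z)%:E | z in [set: Z]].
Proof.
move=> weak_compact lscJ coerJ; set S := [set _ | _ in _].
have JS z : S (J z)%:E by exists z.
have infS z : (ereal_inf S <= (J z)%:E)%E by exact: ereal_inf_lbound.
(* Unless 0 is already a minimizer, [J 0] lies strictly above the infimum, and a minimizing sequence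
   ends up in its sublevel set, bounded by coercivity. *)
have [J0|] := eqVneq (J 0)%:E (ereal_inf S); first by exists 0.
move=> J0neq; have J0 : (ereal_inf S < (J 0)%:E)%E by rewrite lt_def J0neq infS.
have S0 : S != set0 by apply/set0P; exists (J 0)%:E.
have [e eS einf] := ereal_inf_seq S0.
have /choice[u uE] : forall n, exists z, (J z)%:E = e n.
  by move=> n; have [z _ <-] := eS n; exists z.
have [N _ uN] : \forall n \near \oo, (e n < (J 0)%:E)%E.
  apply: (einf [set x | (x < (J 0)%:E)%E]); apply: open_nbhs_nbhs.
  by split=> //; exact: open_ereal_lt_ereal.
have [r coer_r] := coerJ (J 0).
have ur n : `|u (N + n)%N| <= r.
  rewrite leNgt; apply/negP => /ltW/coer_r; rewrite leNgt -lte_fin uE.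
  by rewrite uN//= leq_addr.
have [z [s [sn sz]]] := weak_compact _ r ur.
exists z; apply/eqP; rewrite eq_le infS andbT (le_trans (lscJ _ _ sz))//.
have -> : (fun n => (J (((fun n => u (N + n)%N) \o s) n))%:E) =
          e \o (fun n => N + s n)%N by apply/funext => n /=; rewrite uE.
have Ns : (N + s n)%N @[n --> \oo] --> \oo.
  apply/cvgnyPge => k; near=> n; rewrite (leq_trans _ (leq_addl _ _))//.
  by rewrite (leq_trans _ (sn n))//; near: n; exact: nbhs_infty_ge.
by have [->] := cvg_limn_einf_sup (cvg_comp _ _ Ns einf).
Unshelve. all: by end_near. Qed.

(** The lower limit of [J (u n)] is at least that of [g], which is [J z]. The minorant may depend on
    [z], so tangents at [z] can serve. *)
Lemma seq_weakly_lsc_minorant (J : Z -> R) :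
  (forall (u : nat -> Z) (z : Z), weak_cvg u z ->
    exists2 g : nat -> R, (forall n, g n <= J (u n)) & g @ \oo --> J z) ->
  seq_weakly_lsc J.
Proof.
move=> minorant u z /minorant[g gJ gz].
have /cvg_limn_einf_sup[<- _] : (g n)%:E @[n --> \oo] --> (J z)%:E.
  exact: (cvg_comp _ _ gz).
rewrite !limn_einf_lim; apply: lee_lim; [exact: is_cvg_einfs..|].
apply: nearW => n; apply: le_ereal_inf_tmp => _ [k /= nk <-].
apply: (@le_trans _ _ (g k)%:E); last by rewrite lee_fin.
by apply: ereal_inf_lbound; exists k.
Qed.

End weak_sequential_compactness.

(** * Estimates in the Hilbert space *)

Section hilbert.
Context {R : realType} {D : normedModType R} (ip : {dot D for idfun}).

Lemma dotC u v : ip u v = ip v u.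
Proof. by rewrite hermC expr0 mul1r. Qed.

(** Substitute [A (Ainv e)] for [e] and move [A] across. The cost is built from the inverses,
    whereas symmetry is assumed of the covariances. *)
Lemma inv_self_adjoint (A Ainv : D -> D) :
  (forall d e, ip (A d) e = ip d (A e)) -> cancel Ainv A ->
  forall d e, ip (Ainv d) e = ip d (Ainv e).
Proof. by move=> selfA AinvK d e; rewrite -{1}(AinvK e) -selfA AinvK. Qed.

Context (ipE : hilbert_norm ip).

(** Reduces continuity of [ip] to continuity of the norm. *)
Lemma dot_polarization u v :
  ip u v = 4^-1 * (`|u + v| ^+ 2 - `|u - v| ^+ 2).
Proof.
rewrite !ipE !(linearDl, linearDr, linearNl, linearNr)/= (dotC v u).
by field.
Qed.

Lemma cvg_dot (T : Type) (F : set_system T) (f g : T -> D) (a b : D) :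
  Filter F -> f @ F --> a -> g @ F --> b -> ip (f x) (g x) @[x --> F] --> ip a b.
Proof.
move=> FF fa gb; rewrite dot_polarization.
under eq_fun do rewrite dot_polarization.
apply: cvgMl_tmp; apply: cvgB; rewrite expr2; under eq_fun do rewrite expr2.
  by apply: cvgM; apply: cvg_norm; exact: cvgD.
by apply: cvgM; apply: cvg_norm; exact: cvgB.
Qed.

Lemma cauchy_schwarz_dot u v : `|ip u v| <= `|u| * `|v|.
Proof.
have le_dot x y : ip x y <= `|x| * `|y|.
  have [->|x0] := eqVneq x 0; first by rewrite linear0l normr0 mul0r.
  have [->|y0] := eqVneq y 0; first by rewrite linear0r normr0 mulr0.
  have xy0 : 0 < `|x| * `|y| by rewrite mulr_gt0 ?normr_gt0.
  (* The expansion is 2 |x| |y| (|x| |y| - <x, y>). *)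
  have : 0 <= ip (`|y| *: x - `|x| *: y) (`|y| *: x - `|x| *: y).
    by rewrite -ipE exprn_ge0.
  rewrite !(linearDl, linearDr, linearNl, linearNr)/= !(linearZl_LR, linearZr_LR)/= -!ipE (dotC y x).
  rewrite -(ler_pM2l xy0) /GRing.scale/=; lra.
by rewrite ler_norml le_dot andbT lerNl -linearNl (le_trans (le_dot _ _))// normrN.
Qed.

(** The quadratic part in [q] is the form of [A - B], which is nonnegative; Cauchy-Schwarz bounds
    the remainder [2 * ip w q + k]. *)
Lemma misfit_lower_bound (A B : {linear D -> D}) (y b : D) :
  (forall d e, ip (A d) e = ip d (A e)) ->
  (forall d e, ip (B d) e = ip d (B e)) ->
  positive_definite ip (fun d => A d - B d) ->
  exists2 c : R, 0 <= c & forall q : D,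
    - (c * (1 + `|q|)) <= ip (A (y - q)) (y - q) - ip (B (q - b)) (q - b).
Proof.
move=> selfA selfB AB_pos; pose w := B b - A y.
pose k := ip (A y) y - ip (B b) b.
exists (2 * `|w| + `|k|) => [|q]; first by rewrite addr_ge0// mulr_ge0.
have -> : ip (A (y - q)) (y - q) - ip (B (q - b)) (q - b) =
    ip (A q - B q) q + 2 * ip w q + k.
  rewrite /w /k !linearB/= !(linearDl, linearDr, linearNl, linearNr)/=.
  rewrite (selfA q y) (dotC q) (selfB q b) (dotC q); ring.
have ABq : 0 <= ip (A q - B q) q.
  have [->|/AB_pos/ltW//] := eqVneq q 0.
  by rewrite linear0r.
have /ler_normlP[wq _] := cauchy_schwarz_dot w q.
have kq : `|k| <= `|k| * (1 + `|q|) by rewrite ler_peMr// lerDl.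
have w0 := normr_ge0 w.
have /ler_normlP[k0 _] := lexx `|k|.
lra.
Qed.

End hilbert.

(** * Weak lower semicontinuity and coercivity of the cost *)

Lemma coercive_quadratic_linear (R : realType) (Z : normedModType R)
    (J : Z -> R) (zb : Z) (a c : R) :
  0 < a -> 0 <= c ->
  (forall z, a * `|z - zb| ^+ 2 - c * (1 + `|z|) <= J z) -> coercive J.
Proof.
move=> a0 c0 Jge M.
(* Once t = |z - zb| is at least 1 + x, a t^2 >= a x t; here a x covers the slope c and, as t >= 1,
   the constants c (1 + |zb|) and |M|. *)
pose x := (c + c * (1 + `|zb|) + `|M|) / a.
have x0 : 0 <= x.
  by apply: divr_ge0; rewrite ?(ltW a0)// !addr_ge0// mulr_ge0// addr_ge0.
exists (`|zb| + (1 + x)) => z rz; apply: le_trans (Jge z).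
set t := `|z - zb|.
have zt : `|z| <= t + `|zb| by rewrite -{1}(subrK zb z) ler_normD.
have t1 : 1 + x <= t by lra.
have : c * (1 + `|z|) <= c * t + c * (1 + `|zb|).
  by rewrite -mulrDr ler_wpM2l//; lra.
have : a * x * t <= a * t ^+ 2.
  by rewrite expr2 -mulrA ler_pM2l// ler_wpM2r//; lra.
have -> : a * x = c + c * (1 + `|zb|) + `|M| by rewrite /x mulrC divfK// gt_eqF.
have : c * (1 + `|zb|) + `|M| <= (c * (1 + `|zb|) + `|M|) * t.
  by rewrite ler_peMr ?addr_ge0 ?mulr_ge0 ?addr_ge0//; lra.
have := ler_norm M.
lra.
Qed.

Section cost_function.
Context {R : realType} {Z D : normedModType R} (ip : {dot D for idfun}) {N : nat}.
Context (Binv : {linear Z -> dual Z}) (Rinv Linv : 'I_N.+1 -> {linear D -> D}).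
Context (Q : 'I_N.+1 -> Z -> D) (zb : Z) (y : 'I_N.+1 -> D).
Context (ipE : hilbert_norm ip) (Binv_sym : forall u v, Binv u v = Binv v u).

(** Only the background term is replaced by a minorant; the observation sums converge along [u], so
    the minus sign before the [Linv] sum does no harm. *)
Lemma J_DC_seq_weakly_lsc :
  (forall v, 0 <= Binv v v) ->
  (forall k, continuous (Rinv k)) -> (forall k, continuous (Linv k)) ->
  (forall k, weak_to_strong_continuous (Q k)) ->
  seq_weakly_lsc (J_DC ip Binv Rinv Linv Q zb y).
Proof.
move=> Binv_ge0 Rcont Lcont Qcont; apply: seq_weakly_lsc_minorant => u z uz.
(* The tangent of the quadratic form at [v] lies below it because the form is nonnegative at
   [w - v]. *)
have tangent_le v w : 2 * Binv v w - Binv v v <= Binv w w.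
  have := Binv_ge0 (w - v).
  by rewrite linearB/= !(Binv_sym (w - v)) !linearB/= (Binv_sym w v); lra.
exists (fun n => 2^-1 * (2 * Binv (z - zb) (u n - zb) - Binv (z - zb) (z - zb))
  + 2^-1 * (\sum_(k < N.+1) ip (Rinv k (y k - Q k (u n))) (y k - Q k (u n)))
  - 2^-1 * (\sum_(k < N.+1)
      ip (Linv k (Q k (u n) - Q k zb)) (Q k (u n) - Q k zb))) => [n|].
  by rewrite /J_DC !lerD2r ler_pM2l ?invr_gt0//.
have cvg_sum_ip (f g : 'I_N.+1 -> nat -> D) (a b : 'I_N.+1 -> D) :
    (forall k, f k @ \oo --> a k) -> (forall k, g k @ \oo --> b k) ->
    \sum_(k < N.+1) ip (f k n) (g k n) @[n --> \oo] --> \sum_(k < N.+1) ip (a k) (b k).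
  move=> fa gb; apply: cvg_big => [|k _]; first exact: add_continuous.
  exact: cvg_dot.
have Qu k : Q k (u n) @[n --> \oo] --> Q k z by exact: Qcont.
set f := Binv (z - zb).
have : 2 * f (u n - zb) - f (z - zb) @[n --> \oo] --> 2 * f (z - zb) - f (z - zb).
  apply: cvgB; last exact: cvg_cst.
  apply: cvgMl_tmp; rewrite linearB/=; under eq_fun do rewrite linearB/=.
  by apply: cvgB; [exact: uz|exact: cvg_cst].
(* The tangent touches the form at its base point [z - zb]. *)
rewrite (_ : 2 * _ - _ = f (z - zb)); last by ring.
move=> tangent_cvg.
have yQu k : y k - Q k (u n) @[n --> \oo] --> y k - Q k z.
  by apply: cvgB; [exact: cvg_cst|].
have Quzb k : Q k (u n) - Q k zb @[n --> \oo] --> Q k z - Q k zb.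
  by apply: cvgB; [|exact: cvg_cst].
rewrite /J_DC; apply: cvgB; first apply: cvgD.
- exact: cvgMl_tmp.
- apply: cvgMl_tmp; apply: cvg_sum_ip => k //.
  exact: cvg_comp (yQu k) (Rcont k _).
- apply: cvgMl_tmp; apply: cvg_sum_ip => k //.
  exact: cvg_comp (Quzb k) (Lcont k _).
Qed.

Lemma J_DC_coercive (lmin : R) :
  0 < lmin -> (forall v, lmin * `|v| ^+ 2 <= Binv v v) ->
  (forall k d e, ip (Rinv k d) e = ip d (Rinv k e)) ->
  (forall k d e, ip (Linv k d) e = ip d (Linv k e)) ->
  (forall k, positive_definite ip (fun d => Rinv k d - Linv k d)) ->
  (forall k, linear_growth (Q k)) ->
  coercive (J_DC ip Binv Rinv Linv Q zb y).
Proof.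
move=> lmin0 Binv_ge selfR selfL RL_pos growthQ.
have /choice[c cP] : forall k, exists c : R, 0 <= c /\ forall z,
    - (c * (1 + `|z|)) <= ip (Rinv k (y k - Q k z)) (y k - Q k z)
                        - ip (Linv k (Q k z - Q k zb)) (Q k z - Q k zb).
  move=> k; have [C C0 QC] := growthQ k.
  have [c c0 cP] :=
    misfit_lower_bound ip ipE _ _ (y k) (Q k zb) (selfR k) (selfL k) (RL_pos k).
  (* By linear growth, 1 + |Q k z| <= 1 + C (1 + |z|) <= (1 + C) (1 + |z|). *)
  exists (c * (1 + C)); split=> [|z]; first by rewrite mulr_ge0// addr_ge0// ltW.
  apply: le_trans (cP _); rewrite lerN2 -mulrA ler_wpM2l//.
  by have := QC z; have := normr_ge0 z; lra.
apply: (@coercive_quadratic_linear _ _ _ zb (2^-1 * lmin) (2^-1 * \sum_k c k)).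
- by rewrite mulr_gt0.
- by rewrite mulr_ge0// sumr_ge0// => k _; have [] := cP k.
(* The two observation sums are merged so that they can be bounded index by index. *)
move=> z; rewrite /J_DC -addrA -mulrBr -sumrB -!mulrA -mulrBr.
rewrite -mulrDr ler_pM2l ?invr_gt0// lerD//.
rewrite -mulNr -sumrN mulr_suml; apply: ler_sum => k _.
by rewrite mulNr; have [_] := cP k; exact.
Qed.

End cost_function.

Theorem theoremB1 (R : realType) (Z D : completeNormedModType R)
  (ip : {dot D for idfun}) (N : nat) (zb : Z) (y : 'I_N.+1 -> D)
  (B : dual Z -> Z) (Binv : {linear Z -> dual Z})
  (Rk Rinv Lk Linv : 'I_N.+1 -> {linear D -> D})
  (Q : 'I_N.+1 -> Z -> D) :
  reflexive_space Z ->
  hilbert_norm ip ->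
  covariance_with_precision B Binv ->
  (forall k, covariance_operator ip (Rk k) (Rinv k)) ->
  (forall k, covariance_operator ip (Lk k) (Linv k)) ->
  (forall k, positive_definite ip (fun d => Rinv k d - Linv k d)) ->
  (forall k, weak_to_strong_continuous (Q k)) ->
  (forall k, linear_growth (Q k)) ->
  let J := J_DC ip Binv Rinv Linv Q zb y in
  [/\ seq_weakly_lsc J,
      coercive J &
      exists zstar : Z, (J zstar)%:E = ereal_inf [set (J z)%:E | z in [set: Z]]].
Proof.
move=> reflZ ipE [_ _ _ Binv_sym [lmin lmin0 Binv_ge]] covR covL RL_pos Qcont growthQ J.
have Binv_pos v : v != 0 -> 0 < Binv v v.
  move=> v0; apply: lt_le_trans (Binv_ge v).
  by rewrite mulr_gt0// exprn_gt0// normr_gt0.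
have Binv_ge0 v : 0 <= Binv v v.
  by apply: le_trans (Binv_ge v); rewrite mulr_ge0 ?(ltW lmin0)// exprn_ge0.
have selfR k d e : ip (Rinv k d) e = ip d (Rinv k e).
  by have [_ selfR _ [_ _ RinvK]] := covR k; exact: inv_self_adjoint selfR RinvK d e.
have selfL k d e : ip (Linv k d) e = ip d (Linv k e).
  by have [_ selfL _ [_ _ LinvK]] := covL k; exact: inv_self_adjoint selfL LinvK d e.
have lscJ : seq_weakly_lsc J.
  by apply: J_DC_seq_weakly_lsc => // k; [have [_ _ _ []] := covR k|have [_ _ _ []] := covL k].
have coerJ : coercive J by exact: J_DC_coercive lmin0 Binv_ge selfR selfL RL_pos growthQ.
split=> //; apply: lsc_coercive_minimizer => // u M uM.
exact: symmetric_form_weak_compact reflZ Binv_sym Binv_pos uM.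
Qed.
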